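(* Let $-1<q<1$, let $\mathcal H$ be a real Hilbert space, and let $f,g,h\in\mathcal H$ be unit vectors with $f,h$ linearly independent. Put $\mathbf X:=\mathbf X_f$, $\mathbf Y:=\mathbf X_g$, $\mathbf Z:=\mathbf X_h$. Suppose that $(\tilde X,\tilde Y,\tilde Z)$ is a classical version of the $q$-Gaussian triplet $(\mathbf X,\mathbf Y,\mathbf Z)$ (in this order). Then, almost surely, $$E(\tilde Y\mid \tilde X,\tilde Z)=a\tilde X+b\tilde Z,$$ $$E(\tilde Y^2\mid \tilde X,\tilde Z)=A\tilde X^2+B\tilde X\tilde Z+C\tilde Z^2+D,$$ where $$a=\frac{\langle f,g\rangle-\langle g,h\rangle\langle f,h\rangle}{1-\langle f,h\rangle^2},\qquad b=\frac{\langle g,h\rangle-\langle f,g\rangle\langle f,h\rangle}{1-\langle f,h\rangle^2},$$ $$A=\frac{ab(1-q)\langle f,h\rangle+a^2(1-q\langle f,h\rangle^2)}{1-q\langle f,h\rangle^2},$$ $$B=\frac{ab(1+q)(1-\langle f,h\rangle^2)}{1-q\langle f,h\rangle^2},$$ $$C=\frac{ab(1-q)\langle f,h\rangle+b^2(1-q\langle f,h\rangle^2)}{1-q\langle f,h\rangle^2},$$ $$D=1-A-B\langle f,h\rangle-C.$$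
   Context: $q$-Fock space. Let $\mathcal H$ be a real Hilbert space with complexification $\mathcal H_c$. The $q$-Fock space $\Gamma_q(\mathcal H)$ is the completion of the algebraic direct sum $\mathbb C\Phi\oplus\bigoplus_{n\ge1}\mathcal H_c^{\otimes n}$ ($\Phi$ is a unit vector, the vacuum) in the scalar product $$\langle f_1\otimes\dots\otimes f_n|g_1\otimes\dots\otimes g_m\rangle_q=\begin{cases}\sum_{\sigma\in S_n}q^{|\sigma|}\prod_{j=1}^n\langle f_j,g_{\sigma(j)}\rangle & m=n\\ 0& m\ne n,\end{cases}$$ where $S_n$ is the set of permutations of $\{1,\dots,n\}$ and $|\sigma|=\#\{(i,j):i<j,\ \sigma(i)>\sigma(j)\}$. (This form is known to be positive definite for $-1<q<1$.) For $f\in\mathcal H$, the operator $\mathbf a_f$ on $\Gamma_q(\mathcal H)$ is given by $\mathbf a_f\Phi=0$ and $\mathbf a_f\, f_1\otimes\dots\otimes f_n=\sum_{j=1}^n q^{j-1}\langle f,f_j\rangle f_1\otimes\dots\otimes f_{j-1}\otimes f_{j+1}\otimes\dots\otimes f_n$; its adjoint is given by $\mathbf a_f^*\Phi=f$ and $\mathbf a_f^*\, f_1\otimes\dots\otimes f_n=f\otimes f_1\otimes\dots\otimes f_n$. These are bounded operators satisfying $\mathbf a_f\mathbf a_g^*-q\,\mathbf a_g^*\mathbf a_f=\langle f,g\rangle\mathbf I$. Put $\mathbf X_f=\mathbf a_f+\mathbf a_f^*$. Let $\mathcal A$ be the algebra generated by all $\mathbf X_f$, $f\in\mathcal H$, with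 vacuum state $\mathbb E(\mathbf T)=\langle\Phi|\mathbf T\Phi\rangle_q$. Classical version. An ordered triplet $(\mathbf X,\mathbf Y,\mathbf Z)$ of such operators has a classical version $(\tilde X,\tilde Y,\tilde Z)$ if $\tilde X,\tilde Y,\tilde Z$ are real random variables on a classical probability space, with expectation $E$, such that $\mathbb E(P_1(\mathbf X)P_2(\mathbf Y)P_3(\mathbf Z))=E(P_1(\tilde X)P_2(\tilde Y)P_3(\tilde Z))$ for all polynomials $P_1,P_2,P_3$. $E(\cdot\mid\tilde X,\tilde Z)$ is the usual conditional expectation given the $\sigma$-algebra generated by $\tilde X,\tilde Z$. *)

(* Defs.v *)
From HB Require Import structures.
From mathcomp Require Import all_boot all_order all_algebra all_fingroup.
From mathcomp Require Import complex.
From mathcomp Require Import all_classical all_reals all_analysis.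

Set Implicit Arguments.
Unset Strict Implicit.
Unset Printing Implicit Defensive.

Import Order.TTheory GRing.Theory Num.Theory.
Import numFieldNormedType.Exports.

Local Open Scope classical_set_scope.
Local Open Scope complex_scope.
Local Open Scope ring_scope.

(* [theta] is the conjugation of the scalars: [idfun] over the reals, [conjc]
   over the complex numbers. *)
Record hilbertSpace (K : numFieldType) (theta : K -> K) := HilbertSpace {
  hilbert_sort :> completeNormedModType K;
  hilbert_dot : {dot hilbert_sort for theta};
  hilbert_normE : forall u : hilbert_sort, `|u| ^+ 2 = hilbert_dot u u }.

Notation realHilbertSpace R := (@hilbertSpace R idfun).
Notation complexHilbertSpace R := (@hilbertSpace R[i] (@conjc R)).

(* The forms of sesquilinear.v are linear in the first argument; scalar
   products are taken here linear in the second one, hence the swap. *)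
Definition inner (K : numFieldType) (theta : K -> K)
  (V : hilbertSpace theta) (u v : V) : K := hilbert_dot V v u.

Definition is_adjoint (K : numFieldType) (theta : K -> K)
    (V : hilbertSpace theta) (S T : V -> V) : Prop :=
  forall u v : V, inner (S u) v = inner u (T v).

(* The pair (x, y) stands for x + i y. *)
Definition complexification (R : rcfType) (H : lmodType R) : Type :=
  (H * H)%type.

Section Complexification.
Context (R : rcfType) (H : lmodType R).

HB.instance Definition _ :=
  GRing.Zmodule.copy (complexification H) (H * H)%type.

Definition complexification_scale (c : R[i]) (u : complexification H) :
    complexification H :=
  let: a +i* b := c in (a *: u.1 - b *: u.2, a *: u.2 + b *: u.1).

Fact complexification_scaleA c d u :
  complexification_scale c (complexification_scale d u) =
  complexification_scale (c * d) u.
Proof.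
case: c d u => [a b] [a' b'] [x y]; congr pair => /=.
  rewrite scalerBr !scalerDr !scalerA scalerBl scalerDl !opprD -!addrA.
  by congr (_ + _); rewrite addrA addrC.
rewrite scalerBr !scalerDr !scalerA scalerBl scalerDl -!addrA; congr (_ + _).
by rewrite addrA addrC.
Qed.

Fact complexification_scale1 : left_id 1 complexification_scale.
Proof.
by case=> x y; rewrite /complexification_scale /= !scale1r !scale0r subr0 addr0.
Qed.

Fact complexification_scaleDr : right_distributive complexification_scale +%R.
Proof.
case=> a b [x y] [x' y']; congr pair => /=; rewrite !scalerDr ?opprD.
  by rewrite addrACA.
by rewrite addrACA.
Qed.

Fact complexification_scaleDl v : {morph complexification_scale^~ v : a b / a + b}.
Proof.
case: v => x y [a b] [a' b']; congr pair => /=; rewrite !scalerDl ?opprD.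
  by rewrite addrACA.
by rewrite addrACA.
Qed.

HB.instance Definition _ := GRing.Zmodule_isLmodule.Build R[i]
  (complexification H) complexification_scaleA complexification_scale1
  complexification_scaleDr complexification_scaleDl.

Definition complexify (x : H) : complexification H := (x, 0).

End Complexification.

Definition complexification_inner (R : realType) (H : realHilbertSpace R)
    (u v : complexification H) : R[i] :=
  (inner u.1 v.1 + inner u.2 v.2) +i* (inner u.1 v.2 - inner u.2 v.1).

Definition inversions (n : nat) (s : 'S_n) : nat :=
  #|[set p : 'I_n * 'I_n | (p.1 < p.2)%N && (s p.2 < s p.1)%N]|.

Section QFock.
Context (R : realType) (q : R) (H : realHilbertSpace R).

(* A word [:: f_1; ...; f_n] stands for the tensor f_1 (x) ... (x) f_n, and
   the empty word for the vacuum. *)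
Definition q_form (fs gs : seq (complexification H)) : R[i] :=
  if size fs == size gs then
    \sum_(s : 'S_(size fs)) (q ^+ inversions s)%:C *
      \prod_(j < size fs) complexification_inner (nth 0 fs j) (nth 0 gs (s j))
  else 0.

(* The completion of the algebraic Fock space is given by its characteristic
   properties, which determine it up to unitary isomorphism: a complex Hilbert
   space with a map from words to it that is complex-linear in each letter, has
   the prescribed scalar products, and has total range. *)
Record qFockSpace := QFockSpace {
  fock_space :> complexHilbertSpace R;
  fock_tensor : seq (complexification H) -> fock_space;
  fock_tensor_linear : forall (fs gs : seq (complexification H))
      (c : R[i]) (u v : complexification H),
    fock_tensor (fs ++ (c *: u + v) :: gs) =
    c *: fock_tensor (fs ++ u :: gs) + fock_tensor (fs ++ v :: gs);
  fock_tensor_inner : forall fs gs : seq (complexification H),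
    inner (fock_tensor fs) (fock_tensor gs) = q_form fs gs;
  fock_tensor_total : dense [set u : fock_space |
    exists ws : seq (R[i] * seq (complexification H)),
      u = \sum_(w <- ws) w.1 *: fock_tensor w.2] }.

Variable F : qFockSpace.

Definition vacuum : F := fock_tensor F [::].

Definition vacuum_state (T : F -> F) : R[i] := inner vacuum (T vacuum).

(* Continuity is boundedness of the linear operator [T] (lemma
   linear_bounded_continuous), so that [T] is determined by its values on
   tensors; with the empty word the formula reads T vacuum = 0. Positions are
   counted from 0, whence the exponent [j]. *)
Definition is_annihilation (f : H) (T : {linear F -> F}) : Prop :=
  continuous T /\
  forall fs : seq (complexification H),
    T (fock_tensor F fs) =
    \sum_(j < size fs)
      ((q ^+ j)%:C * complexification_inner (complexify f) (nth 0 fs j)) *: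
      fock_tensor F (take j fs ++ drop j.+1 fs).

Definition is_q_gaussian (f : H) (X : F -> F) : Prop :=
  exists a astar : {linear F -> F},
    [/\ is_annihilation f a, is_adjoint astar a &
        forall u : F, X u = a u + astar u].

Definition poly_op (p : {poly R}) (T : F -> F) (u : F) : F :=
  \sum_(i < size p) (p`_i)%:C *: iter i T u.

(* Integrability makes the classical expectation well defined and finite;
   without it [fine] would return a default value. *)
Definition classical_version (X Y Z : F -> F) (d : measure_display)
    (T : measurableType d) (P : probability T R) (x y z : {RV P >-> R}) : Prop :=
  forall p1 p2 p3 : {poly R},
    let W := fun w : T => p1.[x w] * p2.[y w] * p3.[z w] in
    P.-integrable [set: T] (EFin \o W) /\
    vacuum_state (poly_op p1 X \o poly_op p2 Y \o poly_op p3 Z) =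
    (fine 'E_P[W])%:C.

End QFock.

Section ConditionalExpectation.
Context (d : measure_display) (T : measurableType d) (R : realType)
  (P : probability T R).

Definition is_cond_exp (G : set (set T)) (V E : T -> R) : Prop :=
  [/\ P.-integrable [set: T] (EFin \o V),
      P.-integrable [set: T] (EFin \o E),
      forall B : set R, measurable B -> G (E @^-1` B) &
      forall A : set T, G A ->
        (\int[P]_(w in A) (E w)%:E = \int[P]_(w in A) (V w)%:E)%E].

(* E(V | G) = W almost surely; the first conjunct excludes that this holds for
   want of any version of E(V | G). *)
Definition cond_exp_ae_eq (G : set (set T)) (V W : T -> R) : Prop :=
  (exists E : T -> R, is_cond_exp G V E) /\
  forall E : T -> R, is_cond_exp G V E -> {ae P, forall w, E w = W w}.

End ConditionalExpectation.

(* Main.v *)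
(* The vectors p(X) Phi and p(Z) Phi are combinations of the powers f^n and h^m,
   and the scalar products <f^n, X_g h^m> and <f^n, X_g^2 h^m> are affine,
   resp. quadratic, in <g,f> and <g,h>, with coefficients that depend only on
   n, m and the scalars <f^i, h^j>. Comparing them with the same products for
   X, Z and X^2, XZ, Z^2 gives both regression formulas tested against
   p(X) and r(Z) for all polynomials p, r. As X and Z are bounded, the moments
   of x and z force them to be bounded almost surely; on a bounded interval,
   the polynomials (1 - v^(2n))^(n 4^n) in an affine variable v converge
   boundedly to the indicator of a ray, so that the tested identities extend to
   products of rays and, by Dynkin's theorem, to the sigma-algebra of (x, z). *)

Require Import Defs.
From HB Require Import structures.
From mathcomp Require Import all_boot all_order all_algebra all_fingroup.
From mathcomp Require Import complex.
From mathcomp Require Import ring lra.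
From mathcomp Require Import all_classical all_reals all_analysis.
From mathcomp Require Import measurable_realfun.

Import Order.TTheory GRing.Theory Num.Theory.
Import numFieldNormedType.Exports.

Local Open Scope classical_set_scope.
Local Open Scope ring_scope.

Set Implicit Arguments.
Unset Strict Implicit.
Unset Printing Implicit Defensive.

(** * The q-Fock space *)

Lemma inversionsE (n : nat) (s : 'S_n) :
  inversions s =
  (\sum_(i < n) \sum_(k < n) ((i < k)%N && (s k < s i)%N))%N.
Proof.
rewrite /inversions -sum1_card pair_big /= big_mkcond /=.
by apply: eq_bigr => -[i k] _ /=; rewrite unfold_in /= asboolb; case: ifP.
Qed.

(** Position 0 is inverted exactly with the positions whose value lies below [j], and there are [j]
    of these. The other pairs are the inversions of [s], because [lift] is increasing. *)
Lemma inversions_lift_perm (n : nat) (j : 'I_n.+1) (s : 'S_n) :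
  inversions (lift_perm ord0 j s) = (j + inversions s)%N.
Proof.
rewrite !inversionsE big_ord_recl; congr addn.
- rewrite big_ord_recl /= add0n lift_perm_id.
  under eq_bigr do rewrite lift_perm_lift.
  transitivity (\sum_(m < n) (m < j))%N.
    rewrite [RHS](reindex_inj (@perm_inj _ s)) /=.
    apply: eq_bigr => i _; congr (nat_of_bool _); rewrite /= /bump (leqNgt j).
    by case: (ltnP (s i) j) => h //=; rewrite add1n ltnNge leqW.
  rewrite -(big_mkord xpredT (fun m => nat_of_bool (m < j)%N)) -big_mkcond /=.
  have jn : (j <= n)%N by rewrite -ltnS.
  by rewrite -(@big_nat_widen _ _ _ 0 j n xpredT) // sum_nat_const_nat subn0 muln1.
- apply: eq_bigr => i _; rewrite big_ord_recl /= add0n.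
  apply: eq_bigr => k _; rewrite !lift_perm_lift /= /bump !leq0n !add1n ltnS.
  congr (_ && _); rewrite !ltnNge; congr (~~ _).
  exact: leq_bump2.
Qed.

(** Injectivity suffices, since both sides have cardinality (n+1)!. It sorts a sum over permutations
    by the image of one position. *)
Lemma lift_perm_pair_bij (n : nat) (i : 'I_n.+1) :
  bijective (fun p : 'I_n.+1 * 'S_n => lift_perm i p.1 p.2).
Proof.
apply: inj_card_bij => [[j s] [j' s'] /= e|].
  have ej : j = j' by rewrite -(lift_perm_id i j s) e lift_perm_id.
  rewrite -ej in e *; congr pair; apply/permP => k.
  by apply: (@lift_inj _ j); rewrite -(lift_perm_lift i) e lift_perm_lift.
by rewrite card_prod !card_Sn card_ord factS.
Qed.

(** Deleting the letter at [j] shifts indices in the same way as [lift j], which is what [lift_perm]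
    produces. *)
Lemma nth_take_drop (T : Type) (x0 : T) (s : seq T) (j i : nat) :
  (j < size s)%N -> nth x0 (take j s ++ drop j.+1 s) i = nth x0 s (bump j i).
Proof.
move=> js; rewrite nth_cat size_take js /bump (leqNgt j).
case: ltnP => ij /=; first by rewrite nth_take.
by rewrite nth_drop addSn subnKC // add1n.
Qed.

Section QFormCons.
Local Open Scope complex_scope.
Context (R : realType) (q : R) (H : realHilbertSpace R).

(** The q-analogue of the Laplace expansion along the first row: permutations are grouped by the
    image [j] of the first position, which contributes [q ^+ j]. The right-hand side is the sum that
    defines annihilation, so prepending a letter is adjoint to annihilation. *)
Lemma q_form_cons (f : complexification H) (fs gs : seq (complexification H)) :
  q_form q (f :: fs) gs =
  \sum_(j < size gs) (q ^+ j)%:C * complexification_inner f (nth 0 gs j) *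
    q_form q fs (take j gs ++ drop j.+1 gs).
Proof.
have sgs (j : nat) : (j < size gs)%N ->
    size (take j gs ++ drop j.+1 gs) = (size gs).-1.
  move=> jgs; rewrite size_cat size_take size_drop jgs.
  by rewrite subnS -subn1 addnBA ?subnKC ?subn1 ?subn_gt0 // ltnW.
(* For words of incompatible lengths both sides vanish, the right one term by term. *)
rewrite [LHS]/q_form /=; case: eqP => [e|ne]; last first.
  apply/esym/big1 => j _; rewrite /q_form sgs //.
  case: eqP => [e|_]; last by rewrite mulr0.
  by case: ne; rewrite e prednK // (leq_ltn_trans _ (ltn_ord j)).
rewrite -(big_mkord xpredT (fun j : nat => (q ^+ j)%:C *
  complexification_inner f (nth 0 gs j) *
  q_form q fs (take j gs ++ drop j.+1 gs))) -e big_mkord.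
have ltgs (j : 'I_(size fs).+1) : (j < size gs)%N by rewrite -e ltn_ord.
under [RHS]eq_bigr => j _ do rewrite /q_form sgs // -e eqxx.
rewrite (reindex _ (onW_bij _ (@lift_perm_pair_bij (size fs) ord0))) /=.
rewrite -(pair_big xpredT xpredT (fun j s =>
  (q ^+ inversions (lift_perm ord0 j s))%:C *
  \prod_(k < (size fs).+1) complexification_inner (nth 0 (f :: fs) k)
    (nth 0 gs (lift_perm ord0 j s k)))) /=.
apply: eq_bigr => j _; rewrite mulr_sumr; apply: eq_bigr => s _.
rewrite inversions_lift_perm exprD rmorphM /= big_ord_recl /= lift_perm_id.
rewrite -!mulrA; congr (_ * _); rewrite [RHS]mulrCA; congr (_ * (_ * _)).
by apply: eq_bigr => k _; rewrite lift_perm_lift nth_take_drop.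
Qed.

End QFormCons.

(** * Scalar products in Hilbert spaces *)

Section Inner.
Context (K : numFieldType) (theta : K -> K) (V : hilbertSpace theta).
Implicit Types u v w : V.

Lemma innerDr u v w : inner u (v + w) = inner u v + inner u w.
Proof. exact: linearDl. Qed.

Lemma innerBr u v w : inner u (v - w) = inner u v - inner u w.
Proof. exact: linearBl. Qed.

Lemma innerZr u (c : K) v : inner u (c *: v) = c * inner u v.
Proof. exact: linearZl_LR. Qed.

Lemma inner0r u : inner u 0 = 0.
Proof. exact: linear0l. Qed.

Lemma inner_sumr (I : Type) (r : seq I) (Q : pred I) (E : I -> V) u :
  inner u (\sum_(i <- r | Q i) E i) = \sum_(i <- r | Q i) inner u (E i).
Proof. exact: linear_sumlz. Qed.

Lemma innerDl u v w : inner (u + v) w = inner u w + inner v w.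
Proof. exact: linearDr. Qed.

Lemma innerBl u v w : inner (u - v) w = inner u w - inner v w.
Proof. exact: linearBr. Qed.

Lemma innerZl (c : K) u v : inner (c *: u) v = theta c * inner u v.
Proof. exact: linearZr_LR. Qed.

Lemma inner0l u : inner 0 u = 0.
Proof. exact: linear0r. Qed.

Lemma inner_suml (I : Type) (r : seq I) (Q : pred I) (E : I -> V) u :
  inner (\sum_(i <- r | Q i) E i) u = \sum_(i <- r | Q i) inner (E i) u.
Proof. exact: linear_sumr. Qed.

Lemma inner_conj u v : inner u v = theta (inner v u).
Proof.
by rewrite /inner; case: (hilbert_dot V) => ? [? ? [h]] /=; rewrite h expr0 mul1r.
Qed.

Lemma inner_normE u : inner u u = `|u| ^+ 2.
Proof. by rewrite hilbert_normE. Qed.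

Lemma is_adjoint_sym (S T : V -> V) : is_adjoint S T -> is_adjoint T S.
Proof. by move=> ST u v; rewrite inner_conj -ST -inner_conj. Qed.

End Inner.

(** The vector [w] is a multiple of the component of [u] orthogonal to [v], scaled to avoid
    division. Its square norm is |v|^2 (|u|^2 |v|^2 - |<u,v>|^2), which is nonnegative. *)
Lemma inner_cauchy_schwarz (R : rcfType) (V : complexHilbertSpace R) (u v : V) :
  `|inner u v| <= `|u| * `|v|.
Proof.
have [->|v0] := eqVneq v 0; first by rewrite inner0r !normr0 mulr0.
set w := `|v| ^+ 2 *: u - inner v u *: v.
have vw : inner v w = 0.
  by rewrite innerBr !innerZr inner_normE mulrC subrr.
have : 0 <= inner w w by rewrite inner_normE exprn_ge0.
rewrite {1}/w innerBl [X in _ - X]innerZl vw mulr0 subr0 innerZl.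
have -> : conjc (`|v| ^+ 2) = `|v| ^+ 2 by rewrite -inner_normE -inner_conj.
rewrite pmulr_rge0 ?exprn_gt0 ?normr_gt0 // /w innerBr !innerZr inner_normE.
rewrite (inner_conj v u) mulrC -normCKC subr_ge0 -exprMn.
by rewrite ler_pXn2r // ?nnegrE ?mulr_ge0 //.
Qed.

(** The difference [d] is orthogonal to [S]. If it were nonzero, some [w] in [S] would satisfy |d -
    w| < |d|, whereas |d|^2 = <d, d - w> <= |d| |d - w|. *)
Lemma dense_inner_inj (R : rcfType) (V : complexHilbertSpace R) (S : set V)
    (u v : V) :
  dense S -> (forall w, S w -> inner u w = inner v w) -> u = v.
Proof.
move=> dS uv; apply/eqP; rewrite -subr_eq0; apply/negPn/negP => nz.
set d := u - v in nz.
have d0 : 0 < `|d| by rewrite normr_gt0.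
have := dS (ball d `|d|); case.
- by exists d; exact: ballxx.
- exact: ball_open.
move=> w [+ Sw]; rewrite -ball_normE /= => dw.
have dw0 : inner d w = 0 by rewrite innerBl (uv _ Sw) subrr.
have : `|d| ^+ 2 <= `|d| * `|d - w|.
  apply: le_trans (inner_cauchy_schwarz d (d - w)).
  by rewrite innerBr dw0 subr0 inner_normE ger0_norm // exprn_ge0.
by rewrite expr2 ler_pM2l // (lt_geF dw).
Qed.

(** * Annihilation and creation on tensor powers *)

Section Fock.
Local Open Scope complex_scope.
Context (R : realType) (q : R) (H : realHilbertSpace R) (F : qFockSpace q H).
Implicit Types (f g h : H) (a astar : {linear F -> F}) (u v : F).

(** The q-integer [n]_q. *)
Definition qnum (n : nat) : R := \sum_(j < n) q ^+ j.

Lemma complexification_inner_complexify f g :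
  complexification_inner (complexify f) (complexify g) = (inner f g)%:C.
Proof. by rewrite /complexification_inner /= !inner0r inner0l subr0 addr0. Qed.

Lemma fock_inner_inj u v :
  (forall ws, inner u (fock_tensor F ws) = inner v (fock_tensor F ws)) -> u = v.
Proof.
move=> uv; apply: (dense_inner_inj (@fock_tensor_total _ _ _ F)) => _ [ws ->].
rewrite !inner_sumr; apply: eq_bigr => w _.
by rewrite !innerZr uv.
Qed.

(** Creation is known only as an adjoint. Its values follow by pairing with all tensors, which are
    total, and comparing with [q_form_cons]. *)
Lemma creation_tensor f a astar (ws : seq (complexification H)) :
  is_annihilation f a -> is_adjoint astar a ->
  astar (fock_tensor F ws) = fock_tensor F (complexify f :: ws).
Proof.
move=> [_ aE] aa; apply: fock_inner_inj => vs.
rewrite aa aE inner_sumr fock_tensor_inner q_form_cons.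
by apply: eq_bigr => j _; rewrite innerZr fock_tensor_inner.
Qed.

Definition tensor_power h (n : nat) : F := fock_tensor F (nseq n (complexify h)).

Lemma take_drop_nseq (T : Type) (x : T) (j n : nat) :
  (j < n)%N -> take j (nseq n x) ++ drop j.+1 (nseq n x) = nseq n.-1 x.
Proof.
move=> jn; rewrite take_nseq ?(ltnW jn) // drop_nseq -nseqD.
by rewrite subnS -subn1 addnBA ?subn_gt0 // subnKC ?subn1 // ltnW.
Qed.

(** Every deletion leaves the same power, so only the weights add up. At [n = 0] the truncated
    predecessor is harmless, because [qnum 0] is 0. *)
Lemma annihilation_tensor_power g h a (n : nat) : is_annihilation g a ->
  a (tensor_power h n) = (qnum n * inner g h)%:C *: tensor_power h n.-1.
Proof.
case=> _ ->; rewrite mulr_suml rmorph_sum scaler_suml size_nseq.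
apply: eq_bigr => j _; rewrite nth_nseq ltn_ord take_drop_nseq //.
by rewrite complexification_inner_complexify rmorphM.
Qed.

(** The first term deletes [g']. The others delete a letter [h] sitting one position further right,
    hence the extra factor [q]. *)
Lemma annihilation_cons g g' h a (n : nat) : is_annihilation g a ->
  a (fock_tensor F (complexify g' :: nseq n (complexify h))) =
  (inner g g')%:C *: tensor_power h n +
  (q * qnum n * inner g h)%:C *:
    fock_tensor F (complexify g' :: nseq n.-1 (complexify h)).
Proof.
case=> _ ->; rewrite /= size_nseq big_ord_recl /= expr0 mul1r drop0.
rewrite complexification_inner_complexify; congr (_ + _).
rewrite -mulrA mulr_suml mulr_sumr rmorph_sum scaler_suml.
apply: eq_bigr => j _ /=; rewrite nth_nseq ltn_ord take_drop_nseq ?ltn_ord //.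
by rewrite complexification_inner_complexify mulrA -exprS rmorphM.
Qed.

Local Notation form f h n m := (inner (tensor_power f n) (tensor_power h m)).

(** The creation part is moved to the left factor, where it annihilates; no tensor mixing different
    letters remains. *)
Lemma inner_field_tensor_power f g h a astar (n m : nat) :
  is_annihilation g a -> is_adjoint astar a ->
  inner (tensor_power f n) ((a \+ astar) (tensor_power h m)) =
  (qnum n * inner g f)%:C * form f h n.-1 m +
  (qnum m * inner g h)%:C * form f h n m.-1.
Proof.
move=> aP aa; rewrite /= innerDr (annihilation_tensor_power _ _ aP) innerZr.
rewrite -(is_adjoint_sym aa) (annihilation_tensor_power _ _ aP) innerZl.
by rewrite conjc_real addrC.
Qed.

(** Of the four products, three become annihilations on powers of [f] and [h] once creators change
    sides. Creation against creation contributes both the term with factor [q] and the term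
    <g,g'>. *)
Lemma inner_field_field_tensor_power f g g' h a astar a' astar' (n m : nat) :
  is_annihilation g a -> is_adjoint astar a ->
  is_annihilation g' a' -> is_adjoint astar' a' ->
  inner ((a \+ astar) (tensor_power f n)) ((a' \+ astar') (tensor_power h m)) =
  (qnum n * qnum m *
    (inner g f * inner g' h + q * (inner g h * inner g' f)))%:C *
    form f h n.-1 m.-1 +
  (qnum n * qnum n.-1 * (inner g f * inner g' f))%:C * form f h n.-2 m +
  (qnum m * qnum m.-1 * (inner g h * inner g' h))%:C * form f h n m.-2 +
  (inner g g')%:C * form f h n m.
Proof.
move=> aP aa aP' aa'; rewrite /= !innerDl !innerDr.
have cr k := creation_tensor (nseq k (complexify h)) aP' aa'.
(* This is the q-commutation relation applied to a power of [h]. *)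
rewrite [inner (astar _) (astar' _)]aa (cr m) (annihilation_cons _ _ _ aP).
rewrite innerDr !innerZr -!cr.
rewrite -!(is_adjoint_sym aa') [inner (astar _) _]aa.
rewrite -!/(tensor_power h _).
rewrite (annihilation_tensor_power _ _ aP) (annihilation_tensor_power h _ aP').
rewrite !linearZ /= (annihilation_tensor_power h _ aP).
rewrite !(annihilation_tensor_power f _ aP').
rewrite !(innerZl, innerZr) !conjc_real !rmorphM /= rmorphD /= !rmorphM /=.
by ring.
Qed.

End Fock.

(** * Polynomials in an operator *)

Section PolyOp.
Local Open Scope complex_scope.
Context (R : realType) (q : R) (H : realHilbertSpace R) (F : qFockSpace q H).
Implicit Types (T : {linear F -> F}) (p : {poly R}) (u v : F).

Lemma poly_op_widen p (T : F -> F) u (n : nat) : (size p <= n)%N ->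
  poly_op p T u = \sum_(i < n) (p`_i)%:C *: iter i T u.
Proof.
move=> pn; rewrite /poly_op (big_ord_widen n (fun i => (p`_i)%:C *: iter i T u)) //.
rewrite big_mkcond; apply: eq_bigr => i _; case: ltnP => // pi.
by rewrite nth_default // scale0r.
Qed.

Lemma poly_opMX p T u : poly_op (p * 'X) T u = poly_op p T (T u).
Proof.
rewrite (@poly_op_widen _ _ _ (size p).+1); last first.
  by rewrite (leq_trans (size_polyMleq _ _)) // size_polyX addn2.
rewrite big_ord_recl coefMX eqxx scale0r add0r; apply: eq_bigr => i _.
by rewrite coefMX /= -iterSr.
Qed.

Lemma poly_opC p T u : poly_op p T (T u) = T (poly_op p T u).
Proof.
rewrite /poly_op linear_sum; apply: eq_bigr => i _.
by rewrite linearZ -iterSr iterS.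
Qed.

Lemma poly_op1 T u : poly_op 1 T u = u.
Proof. by rewrite /poly_op size_poly1 big_ord1 coef1 scale1r. Qed.

Lemma poly_opX T u : poly_op 'X T u = T u.
Proof. by rewrite -[X in poly_op X]mul1r poly_opMX poly_op1. Qed.

Lemma poly_opX2 T u : poly_op 'X^2 T u = T (T u).
Proof. by rewrite exprS expr1 poly_opMX poly_opX. Qed.

Lemma poly_op_adjoint p T : is_adjoint T T ->
  is_adjoint (poly_op p T) (poly_op p T).
Proof.
move=> TT u v; rewrite inner_suml inner_sumr; apply: eq_bigr => i _.
rewrite innerZl innerZr conjc_real; congr (_ * _).
by elim: (val i) u v => [//|k IH] u v; rewrite iterS TT IH -iterSr.
Qed.

End PolyOp.

(** * Field operators and the spans of tensor powers *)

Section Field.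
Local Open Scope complex_scope.
Context (R : realType) (q : R) (H : realHilbertSpace R) (F : qFockSpace q H).
Implicit Types (f g h : H) (a astar : {linear F -> F}) (u v : F).

Lemma field_adjoint a astar : is_adjoint astar a ->
  is_adjoint (a \+ astar) (a \+ astar).
Proof.
move=> aa u v; rewrite /= innerDl innerDr.
by rewrite aa (is_adjoint_sym aa) addrC.
Qed.

(** Continuity bounds [a] by some [M], and the same [M] bounds its adjoint, since |a* u|^2 = <u, a
    a* u> <= |u| M |a* u|. *)
Lemma field_bounded f a astar : is_annihilation f a -> is_adjoint astar a ->
  exists M : R, 0 <= M /\ forall u, `|(a \+ astar) u| <= M%:C * `|u|.
Proof.
case=> /linear_bounded_continuous/linear_boundedP[y [yr ab]] _ aa.
pose M := `|y| + 1.
have M0 : 0 <= M by rewrite addr_ge0.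
have aM u : `|a u| <= M * `|u|.
  by apply: ab; rewrite (le_lt_trans (real_ler_norm yr)) // ltrDl.
have asM u : `|astar u| <= M * `|u|.
  have [->|n0] := eqVneq (astar u) 0; first by rewrite normr0 mulr_ge0.
  have n1 : 0 < `|astar u| by rewrite normr_gt0.
  rewrite -(ler_pM2l n1) -expr2.
  have : `|inner (astar u) (astar u)| <= `|u| * (M * `|astar u|).
    by rewrite aa (le_trans (inner_cauchy_schwarz _ _)) // ler_wpM2l.
  rewrite inner_normE ger0_norm ?exprn_ge0 //.
  by congr (_ <= _); ring.
(* Norms in [F] take complex values, whereas the moment bound needs a real constant. *)
have ME : M = (complex.Re M)%:C.
  by apply/esym/RRe_real; rewrite ger0_real.
exists (complex.Re M *+ 2); split; last first.
  move=> u; rewrite mulr2n rmorphD /= -ME mulrDl (le_trans (ler_normD _ _)) //.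
  by rewrite lerD.
by rewrite mulrn_wge0 // -ler0c -ME.
Qed.

Lemma field_tensor_power h a astar (n : nat) :
  is_annihilation h a -> is_adjoint astar a ->
  (a \+ astar) (tensor_power F h n) = tensor_power F h n.+1 +
    (qnum q n * inner h h)%:C *: tensor_power F h n.-1.
Proof.
move=> aP aa; rewrite /= (annihilation_tensor_power _ _ aP).
by rewrite (creation_tensor _ aP aa) addrC.
Qed.

(* The linear span of the powers of h, by its induction principle. *)
Definition tensor_power_span h v : Prop :=
  forall Q : F -> Prop, Q 0 ->
    (forall (c : R[i]) u w, Q u -> Q w -> Q (c *: u + w)) ->
    (forall n, Q (tensor_power F h n)) -> Q v.

Lemma tensor_power_span_field h a astar v :
  is_annihilation h a -> is_adjoint astar a ->
  tensor_power_span h v -> tensor_power_span h ((a \+ astar) v).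
Proof.
move=> aP aa sv Q Q0 QD QT; apply: (sv (fun u => Q ((a \+ astar) u))).
- by rewrite linear0.
- by move=> c u w Qu Qw; rewrite linearP; apply: QD.
- move=> n; rewrite field_tensor_power // addrC.
  exact: QD (QT _) (QT _).
Qed.

Lemma tensor_power_span_poly_op h a astar (p : {poly R}) :
  is_annihilation h a -> is_adjoint astar a ->
  tensor_power_span h (poly_op p (a \+ astar) (vacuum F)).
Proof.
move=> aP aa Q Q0 QD QT; rewrite /poly_op; apply: big_ind => //.
- by move=> u v Qu Qv; rewrite -[u]scale1r; apply: QD.
- move=> i _; rewrite -[X in Q X]addr0; apply: (QD) => //.
  suff : tensor_power_span h (iter i (a \+ astar) (vacuum F)).
    by move/(_ Q Q0 QD QT).
  elim: (val i) => [|k IH]; last exact: tensor_power_span_field.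
  (* The vacuum is the power of [h] with exponent 0. *)
  by move=> Q' _ _ /(_ 0%N).
Qed.

Lemma tensor_power_span_inner0 f h (W : F -> F) u v :
  linear W ->
  (forall n m, inner (tensor_power F f n) (W (tensor_power F h m)) = 0) ->
  tensor_power_span f u -> tensor_power_span h v -> inner u (W v) = 0.
Proof.
move=> lW W0 su sv.
have W00 : W 0 = 0.
  by have := lW (-1) 0 0; rewrite scaleN1r oppr0 add0r scaleN1r addNr.
apply: (sv (fun v => inner u (W v) = 0)) => [|c w w' e e'|m].
- by rewrite W00 inner0r.
- by rewrite lW innerDr innerZr e e' mulr0 addr0.
- apply: (su (fun u => inner u (W (tensor_power F h m)) = 0)) => [|c w w' e e'|n].
  + by rewrite inner0l.
  + by rewrite innerDl innerZl e e' mulr0 addr0.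
  + exact: W0.
Qed.

Lemma vacuum_state_poly_op (X Y Z : {linear F -> F}) (p1 p2 p3 : {poly R}) :
  is_adjoint X X ->
  vacuum_state (poly_op p1 X \o poly_op p2 Y \o poly_op p3 Z) =
  inner (poly_op p1 X (vacuum F)) (poly_op p2 Y (poly_op p3 Z (vacuum F))).
Proof. by move=> XX; rewrite (poly_op_adjoint p1 XX). Qed.

End Field.

(** * Regression identities for the vacuum state *)

Section QGaussianMoments.
Local Open Scope complex_scope.
Context (R : realType) (q : R) (H : realHilbertSpace R) (F : qFockSpace q H).
Context (f g h : H) (X Y Z : {linear F -> F}).
Hypotheses (hX : is_q_gaussian f X) (hY : is_q_gaussian g Y)
  (hZ : is_q_gaussian h Z).

Local Notation form n m := (inner (tensor_power F f n) (tensor_power F h m)).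

Let mean (p1 p2 p3 : {poly R}) : R[i] :=
  vacuum_state (poly_op p1 X \o poly_op p2 Y \o poly_op p3 Z).

Lemma q_gaussian_adjoint f' (T : {linear F -> F}) :
  is_q_gaussian f' T -> is_adjoint T T.
Proof.
case=> a [astar [_ aa TE]] u v.
by rewrite !TE; exact: field_adjoint aa u v.
Qed.

Lemma meanE (p1 p2 p3 : {poly R}) : mean p1 p2 p3 =
  inner (poly_op p1 X (vacuum F)) (poly_op p2 Y (poly_op p3 Z (vacuum F))).
Proof. by apply: vacuum_state_poly_op; exact: q_gaussian_adjoint hX. Qed.

(** Reduces a moment identity for all polynomials to matrix elements between powers of [f] and
    powers of [h]. *)
Lemma inner_poly_op0 (W : {linear F -> F}) (p1 p3 : {poly R}) :
  (forall n m, inner (tensor_power F f n) (W (tensor_power F h m)) = 0) ->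
  inner (poly_op p1 X (vacuum F)) (W (poly_op p3 Z (vacuum F))) = 0.
Proof.
case: hX hZ => [a [astar [aP aa XE]]] [a' [astar' [aP' aa' ZE]]] W0.
have -> : X = a \+ astar :> (F -> F) by apply/funext => u; rewrite XE.
have -> : Z = a' \+ astar' :> (F -> F) by apply/funext => u; rewrite ZE.
apply: (tensor_power_span_inner0 (@linearP _ _ _ _ W) W0);
  exact: tensor_power_span_poly_op.
Qed.

Lemma inner_q_gaussian f' (T : {linear F -> F}) n m : is_q_gaussian f' T ->
  inner (tensor_power F f n) (T (tensor_power F h m)) =
  (qnum q n * inner f' f)%:C * form n.-1 m +
  (qnum q m * inner f' h)%:C * form n m.-1.
Proof.
case=> [a [astar [aP aa TE]]].
by rewrite TE; exact: inner_field_tensor_power.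
Qed.

Lemma inner_q_gaussian2 f1 f2 (T1 T2 : {linear F -> F}) n m :
  is_q_gaussian f1 T1 -> is_q_gaussian f2 T2 ->
  inner (tensor_power F f n) (T1 (T2 (tensor_power F h m))) =
  (qnum q n * qnum q m *
    (inner f1 f * inner f2 h + q * (inner f1 h * inner f2 f)))%:C *
    form n.-1 m.-1 +
  (qnum q n * qnum q n.-1 * (inner f1 f * inner f2 f))%:C * form n.-2 m +
  (qnum q m * qnum q m.-1 * (inner f1 h * inner f2 h))%:C * form n m.-2 +
  (inner f1 f2)%:C * form n m.
Proof.
move=> h1 h2; rewrite -(q_gaussian_adjoint h1).
case: h1 h2 => [a [astar [aP aa TE]]] [a' [astar' [aP' aa' TE']]].
by rewrite TE TE'; exact: inner_field_field_tensor_power.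
Qed.

(** The hypotheses say that [g] and a f + b h have equal scalar products with [f] and with [h]. The
    matrix elements of a field depend on its vector through these two numbers only, so Y - aX - bZ
    has none. *)
Lemma q_gaussian_mean_linear (a b : R) (p1 p3 : {poly R}) :
  inner g f = a * inner f f + b * inner h f ->
  inner g h = a * inner f h + b * inner h h ->
  mean p1 'X p3 = a%:C * mean (p1 * 'X) 1 p3 + b%:C * mean p1 1 (p3 * 'X).
Proof.
move=> gf gh; rewrite !meanE poly_opX !poly_op1 !poly_opMX !poly_opC.
rewrite (q_gaussian_adjoint hX).
apply/eqP; rewrite -subr_eq0 -!innerZr -innerDr -innerBr.
apply/eqP; pose W := Y \- (a%:C \*: X \+ b%:C \*: Z) : {linear F -> F}.
apply: (inner_poly_op0 (W := W)) => n m.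
rewrite /W /= innerBr innerDr !innerZr.
rewrite (inner_q_gaussian _ _ hX) (inner_q_gaussian _ _ hY).
rewrite (inner_q_gaussian _ _ hZ).
rewrite gf gh !(rmorphM, rmorphD) /=.
ring.
Qed.

(** The four hypotheses match, in order, the coefficients of the forms with exponents (n-1, m-1),
    (n-2, m), (n, m-2) and (n, m). *)
Lemma q_gaussian_mean_quadratic (A B C D : R) (p1 p3 : {poly R}) :
  (1 + q) * (inner g f * inner g h) =
    A * ((1 + q) * (inner f f * inner f h)) +
    B * (inner f f * inner h h + q * (inner f h * inner h f)) +
    C * ((1 + q) * (inner h f * inner h h)) ->
  inner g f ^+ 2 = A * inner f f ^+ 2 + B * (inner f f * inner h f) +
    C * inner h f ^+ 2 ->
  inner g h ^+ 2 = A * inner f h ^+ 2 + B * (inner f h * inner h h) +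
    C * inner h h ^+ 2 ->
  inner g g = A * inner f f + B * inner f h + C * inner h h + D ->
  mean p1 'X^2 p3 = A%:C * mean (p1 * 'X^2) 1 p3 +
    B%:C * mean (p1 * 'X) 1 (p3 * 'X) + C%:C * mean p1 1 (p3 * 'X^2) +
    D%:C * mean p1 1 p3.
Proof.
move=> e11 e20 e02 e00; rewrite !meanE !poly_op1 poly_opX2.
rewrite !exprS expr0 mulr1 !mulrA !poly_opMX !poly_opC.
rewrite !(q_gaussian_adjoint hX).
apply/eqP; rewrite -subr_eq0 -!innerZr -!innerDr -innerBr.
(* The mixed term is XZ in this order: X is moved to the left vector by self-adjointness, and Z is
   absorbed in the right polynomial. *)
apply/eqP; pose W := (Y \o Y) \- (A%:C \*: (X \o X) \+ B%:C \*: (X \o Z) \+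
  C%:C \*: (Z \o Z) \+ D%:C \*: idfun) : {linear F -> F}.
apply: (inner_poly_op0 (W := W)) => n m.
rewrite /W /= innerBr !innerDr !innerZr (inner_q_gaussian2 _ _ hX hX).
rewrite (inner_q_gaussian2 _ _ hX hZ) (inner_q_gaussian2 _ _ hZ hZ).
rewrite (inner_q_gaussian2 _ _ hY hY).
have -> : inner g f * inner g h + q * (inner g h * inner g f) =
  (1 + q) * (inner g f * inner g h) by ring.
rewrite e11 -[inner g f * inner g f]expr2 e20 -[inner g h * inner g h]expr2 e02.
rewrite e00 !(rmorphM, rmorphD, rmorph1, rmorphXn) /=.
ring.
Qed.

End QGaussianMoments.

(** * Growth of the vacuum moments *)

Section VacuumMoments.
Local Open Scope complex_scope.
Context (R : realType) (q : R) (H : realHilbertSpace R) (F : qFockSpace q H).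

Lemma norm_vacuum : `|vacuum F| = 1.
Proof.
apply/eqP; rewrite -(@eqrXn2 _ 2) ?normr_ge0 // expr1n -inner_normE.
rewrite /vacuum fock_tensor_inner /q_form /=.
rewrite (big_pred1 (1%g : 'S_0)) => [|s]; last by rewrite (permS0 s); apply/esym/eqP.
rewrite big_ord0 mulr1; suff -> : inversions (1%g : 'S_0) = 0%N by [].
by rewrite inversionsE big_ord0.
Qed.

(** The even moment of order 2k is the square norm of X^k applied to the vacuum, a unit vector, and
    X is bounded by [M]. *)
Lemma q_gaussian_moment_bound (f : H) (X : {linear F -> F}) :
  is_q_gaussian f X -> exists M : R, 0 <= M /\
    forall k, inner (vacuum F) (poly_op 'X^(k.*2) X (vacuum F)) <= (M ^+ k.*2)%:C.
Proof.
move=> hX; have XX := q_gaussian_adjoint hX.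
case: hX => [a [astar [aP aa XE]]].
have [M [M0 bM]] := field_bounded aP aa; exists M; split => // k.
have iterE n : poly_op 'X^n X (vacuum F) = iter n X (vacuum F).
  elim: n => [|n IH]; first by rewrite expr0 poly_op1.
  by rewrite exprSr poly_opMX poly_opC IH.
have iterN n : `|iter n X (vacuum F)| <= (M ^+ n)%:C.
  elim: n => [|n IH]; first by rewrite norm_vacuum.
  rewrite iterS XE (le_trans (bM _)) // exprS rmorphM /= ler_wpM2l //.
  by rewrite ler0c.
have -> : inner (vacuum F) (poly_op 'X^(k.*2) X (vacuum F)) =
    `|iter k X (vacuum F)| ^+ 2.
  have sym n u v : inner u (iter n X v) = inner (iter n X u) v.
    by elim: n v => [//|n IH] v; rewrite iterSr IH -XX.
  by rewrite iterE -inner_normE -addnn iterD sym.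
by rewrite -muln2 exprM rmorphXn lerXn2r // nnegrE // ler0c exprn_ge0.
Qed.

End VacuumMoments.

(** * Determination by polynomial moments *)

Section StepPolynomials.
Context (R : realType).

Lemma bernoulli_ge (y : R) (m : nat) : 0 <= y -> 1 + m%:R * y <= (1 + y) ^+ m.
Proof.
move=> y0; elim: m => [|m IH]; first by rewrite mul0r addr0 expr0.
rewrite exprS; apply: le_trans (ler_wpM2l _ IH); last by rewrite addr_ge0.
have : 0 <= m%:R * (y * y) by rewrite !mulr_ge0.
rewrite -natr1; nra.
Qed.

Lemma bernoulli_le (y : R) (m : nat) : 0 <= y <= 1 -> 1 - m%:R * y <= (1 - y) ^+ m.
Proof.
move=> /andP[y0 y1]; elim: m => [|m IH]; first by rewrite mul0r subr0 expr0.
rewrite exprS; apply: le_trans (ler_wpM2l _ IH); last by rewrite subr_ge0.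
have : 0 <= m%:R * (y * y) by rewrite !mulr_ge0.
rewrite -natr1; nra.
Qed.

(** From (1 - y)^m (1 + y)^m <= 1 and Bernoulli's inequality for the second factor. *)
Lemma expr_onem_le (y : R) (m : nat) : 0 <= y <= 1 ->
  (1 - y) ^+ m <= (1 + m%:R * y)^-1.
Proof.
move=> /andP[y0 y1]; have py : 0 < 1 + m%:R * y.
  by rewrite ltr_pwDl // mulr_ge0.
rewrite -[leRHS]mul1r ler_pdivlMr //.
apply: (@le_trans _ _ ((1 - y) ^+ m * (1 + y) ^+ m)).
  by rewrite ler_wpM2l ?bernoulli_ge // exprn_ge0 // subr_ge0.
rewrite -exprMn exprn_ile1 //; last by nra.
by rewrite mulr_ge0 ?subr_ge0 // addr_ge0.
Qed.

(** Writing 1/r = 1 + h, Bernoulli's inequality bounds n r^n by 1/h; the remaining factor r^n tends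
    to 0. The case r = 0 is separate because of the inverse. *)
Lemma cvg_natr_expr (r : R) : 0 <= r < 1 -> (fun n => n%:R * r ^+ n.*2) @ \oo --> 0.
Proof.
move=> /andP[r0 r1]; have [->|rn0] := eqVneq r 0.
  apply: cvg_near_cst; near=> n; rewrite expr0n double_eq0.
  have -> : (n == 0%N) = false by apply/negbTE; rewrite -lt0n; near: n; exists 1%N.
  by rewrite mulr0.
have rp : 0 < r by rewrite lt_neqAle eq_sym rn0.
set h := r^-1 - 1.
have h0 : 0 < h by rewrite subr_gt0 invf_gt1.
have bnd n : n%:R * r ^+ n <= h^-1.
  have := bernoulli_ge n (ltW h0).
  have -> : 1 + h = r^-1 by rewrite /h addrC subrK.
  rewrite exprVn => H.
  have rn : 0 < r ^+ n by rewrite exprn_gt0.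
  have : (n%:R * h) <= (r ^+ n)^-1 by rewrite (le_trans _ H) // lerDr.
  rewrite -[leRHS]mul1r ler_pdivlMr // => H'.
  by rewrite -[leRHS]mul1r ler_pdivlMr // mulrAC.
apply: (@squeeze_cvgr _ _ _ _ (fun=> 0) (fun n => h^-1 * r ^+ n)).
- apply: nearW => n; rewrite mulr_ge0 ?exprn_ge0 //= -addnn exprD mulrA.
  by rewrite ler_wpM2r // exprn_ge0.
- exact: cvg_cst.
- by apply: cvg_geometric; rewrite ger0_norm.
Unshelve. all: by end_near. Qed.

(** The exponent times v^(2n) equals n (2v)^(2n). For v < 1/2 this tends to 0, and Bernoulli's
    inequality gives the limit 1. For v >= 1/2 it is at least n, and the power is at most
    1/(n+1). *)
Lemma cvg_step (v : R) : 0 <= v <= 1 ->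
  (fun n => (1 - v ^+ n.*2) ^+ (n * 4 ^ n)) @ \oo --> ((v < 2^-1)%R%:R : R).
Proof.
move=> /andP[v0 v1].
have vn n : 0 <= v ^+ n <= 1 by rewrite exprn_ge0 // exprn_ile1.
have e4 n : (n * 4 ^ n)%:R * v ^+ n.*2 = n%:R * (2 * v) ^+ n.*2 :> R.
  by rewrite natrM natrX exprMn -mulrA -mul2n [2 ^+ _]exprM -(natrX _ 2 2).
have [v2|v2] := ltP v 2^-1; last first.
  apply: (@squeeze_cvgr _ _ _ _ (fun=> 0) (@harmonic R)).
  - apply: nearW => n; rewrite exprn_ge0 ?subr_ge0; last by case/andP: (vn n.*2).
    apply: (le_trans (expr_onem_le _ (vn _))).
    rewrite /harmonic lef_pV2 ?posrE ?ltr0n // ?e4 //.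
      rewrite -nat1r lerD2l ler_peMr // exprn_ege1 //.
      by lra.
    have d0 : 0 <= n%:R * (2 * v) ^+ n.*2.
      by rewrite mulr_ge0 // exprn_ge0 // mulr_ge0.
    by apply: ltr_pwDl.
  - exact: cvg_cst.
  - exact: cvg_harmonic.
apply: (@squeeze_cvgr _ _ _ _ (fun n => 1 - n%:R * (2 * v) ^+ n.*2) (fun=> 1)).
- apply: nearW => n; rewrite -e4 bernoulli_le //=.
  by rewrite exprn_ile1 ?subr_ge0 ?gerBl //; case/andP: (vn n.*2).
- rewrite -[X in _ --> X]subr0; apply: cvgB; first exact: cvg_cst.
  by apply: cvg_natr_expr; rewrite mulr_ge0 //= -ltr_pdivlMl // mulr1.
- exact: cvg_cst.
Qed.

Lemma step_polynomials (M s : R) : exists p : nat -> {poly R},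
  (forall n u, `|u| <= M -> `|(p n).[u]| <= 1) /\
  forall u, `|u| <= M -> (fun n => (p n).[u]) @ \oo --> ((u < s)%R%:R : R).
Proof.
(* [N] is positive and bounds |u - s| on the interval, so the affine map of slope 1/(2N) sending [s]
   to 1/2 takes values in [0, 1] there. *)
pose N := `|M| + `|s| + 1.
have N0 : 0 < N by rewrite ltr_wpDl // addr_ge0.
pose k := (2 * N)^-1.
have k0 : 0 < k by rewrite invr_gt0 mulr_gt0.
pose l : {poly R} := (2^-1)%:P + k *: ('X - s%:P).
pose v u := 2^-1 + k * (u - s).
have lE u : l.[u] = v u by rewrite /l /v !hornerE.
have vI u : `|u| <= M -> 0 <= v u <= 1.
  move=> uM; have uN : `|u - s| <= N.
    rewrite (le_trans (ler_normB _ _)) // /N -addrA lerD ?(le_trans uM) ?ler_norm //.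
    by rewrite lerDl.
  have : `|k * (u - s)| <= 2^-1.
    rewrite normrM gtr0_norm // /k invfM -mulrA ler_piMr //.
    by rewrite mulrC ler_pdivrMr // mul1r.
  by rewrite ler_norml /v => /andP[? ?]; apply/andP; split; lra.
have vs u : (v u < 2^-1) = (u < s).
  by rewrite /v gtrDl pmulr_rlt0 // subr_lt0.
exists (fun n => (1 - l ^+ n.*2) ^+ (n * 4 ^ n)).
have pE n u :
    ((1 - l ^+ n.*2) ^+ (n * 4 ^ n)).[u] = (1 - v u ^+ n.*2) ^+ (n * 4 ^ n).
  by rewrite -lE; move: l {lE} => l; rewrite !hornerE.
split=> [n u uM|u uM].
  have /andP[v0 v1] := vI _ uM.
  rewrite pE normrX exprn_ile1 // ger0_norm ?subr_ge0 ?exprn_ile1 //.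
  by rewrite gerBl exprn_ge0.
under eq_fun do rewrite pE.
by rewrite -vs; exact: cvg_step (vI _ uM).
Qed.

End StepPolynomials.

(** * Almost sure bounds from moments *)

Section MomentProblem.
Context (d : measure_display) (T : measurableType d) (R : realType)
  (P : probability T R).

(** Markov's inequality for the power 2k bounds the probability of |x| >= M + 1 by (M/(M+1))^(2k)
    for every k. The added 1 makes the ratio smaller than 1. *)
Lemma ae_bounded_of_moments (x : {RV P >-> R}) (M : R) : 0 <= M ->
  (forall k, 'E_P[(fun w => x w ^+ k.*2)%R] <= (M ^+ k.*2)%:E)%E ->
  {ae P, forall w, `|x w| <= M + 1}.
Proof.
move=> M0 bM; have M1 : 0 < M + 1 by rewrite ltr_wpDl.
pose A := [set w | ((M + 1)%:E <= `|(x w)%:E|)%E].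
have mA : measurable A.
  rewrite -[A]setTI; apply: emeasurable_fun_c_infty => //.
  by apply: measurableT_comp => //; exact/measurable_EFinP.
exists A; split => //; last first.
  by move=> w /= /negP; rewrite -ltNge /A /= lee_fin => /ltW.
have fA : P A \is a fin_num by exact: fin_num_measure.
apply/eqP; rewrite -(fineK fA) eqe eq_le fine_ge0 // andbT leNgt.
apply/negP => p0.
have bA k : fine (P A) <= ((M / (M + 1)) ^+ 2) ^+ k.
  have := @markov _ _ _ P x (fun r => r ^+ k.*2) (M + 1) M1 (exprn_measurable _).
  have /[swap] /[apply] : forall r : R, 0 <= r -> 0 <= r ^+ k.*2.
    by move=> r r0; rewrite exprn_ge0.
  have /[swap] /[apply] :
      {in Num.nneg &, {homo (fun r : R => r ^+ k.*2) : u v / u <= v}}.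
    by move=> u v u0 v0 uv; rewrite lerXn2r.
  have -> : (fun r => r ^+ k.*2) \o (fun r => `|r|) \o x = (fun w => x w ^+ k.*2).
    by apply/funext => w /=; rewrite -!mul2n !exprM real_normK // num_real.
  move=> /le_trans /(_ (bM k)); rewrite -(fineK fA) -EFinM lee_fin.
  rewrite mulrC -ler_pdivlMr ?exprn_gt0 // => /le_trans; apply.
  by rewrite -exprM mul2n expr_div_n.
have : (GRing.exp ((M / (M + 1)) ^+ 2) : nat -> R) @ \oo --> 0.
  apply: cvg_expr; rewrite ger0_norm ?exprn_ge0 ?divr_ge0 //; last exact: ltW.
  by rewrite exprn_ilt1 ?divr_ge0 // ?ltr_pdivrMr ?mul1r ?ltrDl // ltW.
move=> /cvgr_lt /(_ _ p0) /filter_ex[k].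
by rewrite ltNge bA.
Qed.

End MomentProblem.

(** * From polynomial test functions to the sigma-algebra of two variables *)

Section PolynomialMoments.
Context (d : measure_display) (T : measurableType d) (R : realType)
  (P : probability T R) (x z : {RV P >-> R}).

Let ray (s t : R) : set T := [set w | x w < s /\ z w < t].

Lemma measurable_ray s t : measurable (ray s t).
Proof.
have -> : ray s t = x @^-1` `]-oo, s[ `&` z @^-1` `]-oo, t[.
  by apply/seteqP; split => w; rewrite /ray /= !in_itv.
by apply: measurableI; exact: measurable_funPTI.
Qed.

(** A condition on one variable alone is the countable union of quadrants whose other bound runs
    through the naturals, and open left rays generate the Borel sets. *)
Lemma g_sigma_preimageU_rays :
  g_sigma_preimageU x z `<=` <<s [set A | exists s t, A = ray s t] >>.
Proof.
set S := <<s _ >>; have sS : sigma_algebra setT S by exact: smallest_sigma_algebra.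
have rayS s t : S (ray s t) by apply: sub_sigma_algebra; exists s, t.
have archi (y : R) : exists n : nat, y < n%:R.
  by exists (Num.truncn y).+1; exact: truncnS_gt.
have rayx s : S (x @^-1` `]-oo, s[).
  have -> : x @^-1` `]-oo, s[ = \bigcup_n ray s n%:R.
    apply/seteqP; split => [w|w [n _ []]]; rewrite /= in_itv /= => // xs.
    by have [n zn] := archi (z w); exists n.
  by case: sS => _ _; apply.
have rayz t : S (z @^-1` `]-oo, t[).
  have -> : z @^-1` `]-oo, t[ = \bigcup_n ray n%:R t.
    apply/seteqP; split => [w|w [n _ []]]; rewrite /= in_itv /= => // zt.
    by have [n xn] := archi (x w); exists n.
  by case: sS => _ _; apply.
have gen (y : T -> R) : (forall s, S (y @^-1` `]-oo, s[)) ->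
    preimage_set_system setT y measurable `<=` S.
  move=> yS.
  have -> : @measurable _ R = (@RGenInftyO.G R).-sigma.-measurable.
    exact: RGenInftyO.measurableE.
  rewrite -g_sigma_preimageE; apply: smallest_sub => // _ [_ [s ->] <-].
  by rewrite setTI.
by apply: smallest_sub => //; rewrite subUset; split; exact: gen.
Qed.

Lemma g_sigma_preimageU_measurable A : g_sigma_preimageU x z A -> measurable A.
Proof.
move=> /g_sigma_preimageU_rays; apply.
split; first exact: sigma_algebra_measurable.
by move=> _ [s [t ->]]; exact: measurable_ray.
Qed.

Context (phi : T -> R) (M N : R).
Hypotheses (iphi : P.-integrable setT (EFin \o phi))
  (xM : {ae P, forall w, `|x w| <= M}) (zN : {ae P, forall w, `|z w| <= N})
  (phi0 : forall p r : {poly R},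
    (\int[P]_w (p.[x w] * r.[z w] * phi w)%:E = 0)%E).

(** Dominated convergence along products of step polynomials: almost surely these are bounded by 1
    and converge to the indicator of the quadrant, so |phi| dominates, and every integral in the
    sequence is 0. *)
Lemma integral_ray0 s t : (\int[P]_(w in ray s t) (phi w)%:E = 0)%E.
Proof.
have [p [p1 pc]] := step_polynomials M s.
have [r [r1 rc]] := step_polynomials N t.
have mphi : measurable_fun setT phi.
  by apply/measurable_EFinP; exact: measurable_int iphi.
have mhorner (u : {RV P >-> R}) (l : {poly R}) :
    measurable_fun setT (fun w => l.[u w]).
  apply: (measurableT_comp (f := horner l)) => //.
  by apply: continuous_measurable_fun; exact: continuous_horner.
pose f_ n w := ((p n).[x w] * (r n).[z w] * phi w)%:E.
have [_ _] : [/\ P.-integrable setT ((EFin \o phi) \_ (ray s t)),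
    [sequence (\int[P]_w `|f_ n w - ((EFin \o phi) \_ (ray s t)) w|)%E]_n
      @ \oo --> 0%E &
    [sequence (\int[P]_w f_ n w)%E]_n
      @ \oo --> (\int[P]_w ((EFin \o phi) \_ (ray s t)) w)%E].
  apply: (dominated_convergence measurableT (g := fun w => `|phi w|%:E)).
  - move=> n; apply/measurable_EFinP.
    by apply: measurable_funM => //; apply: measurable_funM.
  - apply/(measurable_restrictT _ (measurable_ray s t)).
    by apply: measurable_funTS; apply/measurable_EFinP.
  - apply: filterS2 xM zN => w xw zw _.
    have -> : ((EFin \o phi) \_ (ray s t)) w =
        ((x w < s)%R%:R * (z w < t)%R%:R * phi w)%:E.
      rewrite patchE; case: ifPn => [/set_mem[-> ->]|]; first by rewrite !mul1r.
      rewrite notin_setE => /not_andP nr; congr EFin.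
      by case: nr => /negP/negbTE ->; rewrite ?(mulr0, mul0r).
    apply: cvg_EFin; first exact: nearW.
    by apply: cvgM; [apply: cvgM; [exact: pc|exact: rc]|exact: cvg_cst].
  - exact: integrable_norm iphi.
  - apply: filterS2 xM zN => w xw zw n _; rewrite /f_ /= lee_fin !normrM.
    rewrite -[leRHS]mul1r ler_wpM2r // -[leRHS]mul1r.
    by apply: ler_pM => //; [exact: p1|exact: r1].
rewrite -integral_mkcond; have -> : [sequence (\int[P]_w f_ n w)%E]_n = cst 0%E.
  by apply/funext => n; exact: phi0.
by move=> /(cvg_lim (@ereal_hausdorff R)) <-; exact: lim_cst.
Qed.

(** Dynkin's argument: the quadrants are stable under intersection, and the measurable sets on which
    [phi] integrates to 0 form a lambda-system. The whole space is covered by the constant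
    polynomials 1. *)
Lemma integral_preimageU0 A : g_sigma_preimageU x z A ->
  (\int[P]_(w in A) (phi w)%:E = 0)%E.
Proof.
have iphiA B : measurable B -> P.-integrable B (EFin \o phi).
  by move=> mB; apply: integrableS iphi.
move=> /g_sigma_preimageU_rays.
suff : <<s [set A | exists s t, A = ray s t] >> `<=`
    [set B | measurable B /\ (\int[P]_(w in B) (phi w)%:E = 0)%E].
  by move=> /[apply] -[].
apply: lambda_system_subset => //.
- move=> _ _ [s [t ->]] [s' [t' ->]]; exists (Num.min s s'), (Num.min t t').
  apply/seteqP; split => [w [[? ?] [? ?]]|w [/= + +]]; rewrite /ray /= !lt_min.
    by split; apply/andP.
  by move=> /andP[? ?] /andP[? ?]; do ! split.
- apply/dynkin_lambda_system; split.
  + split => //; rewrite -[RHS](phi0 1 1); apply: eq_integral => w _.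
    by rewrite !hornerC !mul1r.
  + move=> B [mB B0]; split; first exact: measurableC.
    have := phi0 1 1.
    rewrite (eq_integral (fun w => (phi w)%:E)); last first.
      by move=> w _; rewrite !hornerC !mul1r.
    rewrite -(setUv B) integral_setU //; first by rewrite B0 add0e.
    * exact: measurableC.
    * by rewrite setUv; exact: measurable_int iphi.
    * by apply/disj_setPS; rewrite setICr.
  + move=> B tB B0.
    have mB k : measurable (B k) by case: (B0 k).
    split; first exact: bigcupT_measurable.
    rewrite integral_bigcup //; last exact/iphiA/bigcupT_measurable.
    by rewrite eseries0 // => k _ _; case: (B0 k).
- move=> _ [s [t ->]]; split; [exact: measurable_ray|exact: integral_ray0].
Qed.

End PolynomialMoments.

(** * Almost sure uniqueness of conditional expectations *)

Section CondExp.
Context (d : measure_display) (T : measurableType d) (R : realType)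
  (P : probability T R) (G0 : set (set T)).
Let G := <<s G0 >>.
Hypothesis G_measurable : G `<=` measurable.

(** Turns the condition on preimages into measurability, so that stability under sums and products
    applies. *)
Lemma measurable_fun_g_sigma (V : T -> R) :
  (forall B : set R, measurable B -> G (V @^-1` B)) <->
  measurable_fun [set: g_sigma_algebraType G0] (V : g_sigma_algebraType G0 -> R).
Proof.
split=> [VG _ B mB|mV B mB]; first by rewrite setTI; exact: VG.
by rewrite -[X in G X]setTI; exact: mV.
Qed.

(** The set [A] belongs to [G], and there E - W is nonnegative with integral 0, hence almost surely
    0. Outside [A] the inequality is strict. *)
Lemma cond_exp_le_ae (E W : T -> R) :
  P.-integrable [set: T] (EFin \o E) -> P.-integrable [set: T] (EFin \o W) ->
  (forall B : set R, measurable B -> G (E @^-1` B)) ->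
  (forall B : set R, measurable B -> G (W @^-1` B)) ->
  (forall A : set T, G A ->
     (\int[P]_(w in A) (E w)%:E = \int[P]_(w in A) (W w)%:E)%E) ->
  {ae P, forall w, E w <= W w}.
Proof.
move=> iE iW /measurable_fun_g_sigma mE /measurable_fun_g_sigma mW EW.
pose A : set T := [set w | W w <= E w].
have GA : G A.
  have := @measurable_funB _ (g_sigma_algebraType G0) _ setT E W mE mW.
  move=> /(_ measurableT `[0, +oo[%classic (measurable_itv _)).
  rewrite setTI; congr G; apply/seteqP; split => w;
    by rewrite /A /= in_itv /= andbT subr_ge0.
have mA := G_measurable GA.
have iA (V : T -> R) : P.-integrable [set: T] (EFin \o V) ->
    P.-integrable A (EFin \o V).
  by move=> iV; apply: integrableS iV.
have : (\int[P]_(w in A) `|(E w - W w)%:E| = 0)%E.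
  rewrite (eq_integral (fun w => (E w)%:E - (W w)%:E)%E); last first.
    by move=> w /set_mem wA; rewrite gee0_abs // lee_fin subr_ge0.
  rewrite integralB // ?EW //; [|exact: iA|exact: iA].
  rewrite subee // -?EW //; apply: integrable_fin_num => //; exact: iA.
move=> /ae_eq_integral_abs; case=> //.
  have := integrableB mA (iA _ iE) (iA _ iW).
  exact: measurable_int.
move=> N [mN N0 sN]; exists N; split => // w /= Ew; apply: sN => /= /(_ _) H.
apply: Ew; rewrite -subr_le0; case: (leP (W w) (E w)) => [wA|]; last first.
  by rewrite subr_le0 => /ltW.
by have [->] := H wA.
Qed.

Lemma cond_exp_ae_eqI (V W : T -> R) :
  P.-integrable [set: T] (EFin \o V) -> P.-integrable [set: T] (EFin \o W) ->
  (forall B : set R, measurable B -> G (W @^-1` B)) ->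
  (forall A : set T, G A ->
     (\int[P]_(w in A) (W w)%:E = \int[P]_(w in A) (V w)%:E)%E) ->
  cond_exp_ae_eq P G V W.
Proof.
move=> iV iW GW WV; split; first by exists W; split.
move=> E [_ iE GE EV].
have EW A : G A -> (\int[P]_(w in A) (E w)%:E = \int[P]_(w in A) (W w)%:E)%E.
  by move=> GA; rewrite EV // WV.
have le1 := cond_exp_le_ae iE iW GE GW EW.
have le2 := cond_exp_le_ae iW iE GW GE (fun A GA => esym (EW A GA)).
by apply: filterS2 le1 le2 => w l1 l2; apply/eqP; rewrite eq_le l1.
Qed.

End CondExp.

(** * Conditional expectations of a classical version *)

Section ClassicalVersion.
Context (d : measure_display) (T : measurableType d) (R : realType)
  (P : probability T R).

Lemma expectation_fineK (U : T -> R) : P.-integrable [set: T] (EFin \o U) ->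
  'E_P[U]%E = (fine 'E_P[U])%:E.
Proof. by move=> iU; rewrite fineK // unlock; exact: integrable_fin_num. Qed.

Lemma expectation_lincomb (c : R) (U V : T -> R) :
  P.-integrable [set: T] (EFin \o U) -> P.-integrable [set: T] (EFin \o V) ->
  P.-integrable [set: T] (EFin \o (fun w => c * U w + V w)) /\
  fine 'E_P[(fun w => c * U w + V w)%R] = c * fine 'E_P[U] + fine 'E_P[V].
Proof.
move=> iU iV; have icU := integrableZl measurableT c iU.
split; first exact: integrableD icU iV.
rewrite unlock; have -> : (\int[P]_w (c * U w + V w)%:E =
    c%:E * \int[P]_w (U w)%:E + \int[P]_w (V w)%:E)%E.
  by rewrite -integralZl // -integralD.
by rewrite fineD ?fineM ?fin_numM // ?integrable_fin_num.
Qed.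

Context (x z : {RV P >-> R}).
Let G := g_sigma_preimageU x z.

(** One expression serves both regressions: the linear one with A, B, C, D zero, the quadratic one
    with a, b zero. *)
Lemma g_sigma_preimageU_polynomial (A B C D a b : R) :
  forall S : set R, measurable S -> G ((fun w =>
    A * x w ^+ 2 + B * x w * z w + C * z w ^+ 2 + D + a * x w + b * z w)
     @^-1` S).
Proof.
apply: (measurable_fun_g_sigma _ _).2.
set T' := g_sigma_algebraType _.
have mx : measurable_fun [set: T'] (x : T' -> R).
  by move=> _ Y mY; apply: sub_sigma_algebra; left; exists Y.
have mz : measurable_fun [set: T'] (z : T' -> R).
  by move=> _ Y mY; apply: sub_sigma_algebra; right; exists Y.
by do ?[exact: measurable_funX | apply: measurable_funD | apply: measurable_funM].
Qed.

Lemma cond_exp_of_moments (V W : T -> R) (M N : R) :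
  P.-integrable [set: T] (EFin \o V) -> P.-integrable [set: T] (EFin \o W) ->
  (forall S : set R, measurable S -> G (W @^-1` S)) ->
  {ae P, forall w, `|x w| <= M} -> {ae P, forall w, `|z w| <= N} ->
  (forall p r : {poly R},
    'E_P[(fun w => p.[x w] * r.[z w] * (V w - W w))%R] = 0)%E ->
  cond_exp_ae_eq P G V W.
Proof.
move=> iV iW GW xM zN VW0; apply: cond_exp_ae_eqI => //.
  exact: g_sigma_preimageU_measurable.
move=> A GA; have mA := g_sigma_preimageU_measurable GA.
have iA U : P.-integrable [set: T] (EFin \o U) -> P.-integrable A (EFin \o U).
  by move=> iU; apply: integrableS iU.
have iVW : P.-integrable [set: T] (EFin \o (fun w => V w - W w)).
  exact: (integrableB measurableT iV iW).
have phi0 (p r : {poly R}) :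
    (\int[P]_w (p.[x w] * r.[z w] * (V w - W w))%:E = 0)%E.
  by rewrite -(VW0 p r) unlock.
have fV : (\int[P]_(w in A) (V w)%:E)%E \is a fin_num.
  by apply: integrable_fin_num => //; exact: iA.
have fW : (\int[P]_(w in A) (W w)%:E)%E \is a fin_num.
  by apply: integrable_fin_num => //; exact: iA.
have := integral_preimageU0 iVW xM zN phi0 GA.
rewrite integralB_EFin //; [|exact: iA|exact: iA].
by rewrite -(fineK fV) -(fineK fW) -EFinB => -[/subr0_eq ->].
Qed.

End ClassicalVersion.

(** Replaces a plain map by the linear one required in the moment computations. *)
Lemma q_gaussian_linear (R : realType) (q : R) (H : realHilbertSpace R)
    (F : qFockSpace q H) (f : H) (X : F -> F) :
  is_q_gaussian f X -> exists X' : {linear F -> F}, X = X'.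
Proof.
case=> a [astar [_ _ XE]]; exists (a \+ astar : {linear F -> F}).
exact/funext.
Qed.

Lemma real_complex_inj (R : rcfType) (u v : R) :
  (real_complex R u = real_complex R v) -> u = v.
Proof. by case. Qed.

(** * Transfer of the regression identities to a classical version *)

Section ClassicalVersionMoments.
Context (R : realType) (q : R) (H : realHilbertSpace R) (F : qFockSpace q H).
Context (f g h : H) (X Y Z : {linear F -> F}).
Hypotheses (hX : is_q_gaussian f X) (hY : is_q_gaussian g Y)
  (hZ : is_q_gaussian h Z).
Context (d : measure_display) (T : measurableType d) (P : probability T R)
  (x y z : {RV P >-> R}).
Hypothesis hcl : classical_version X Y Z x y z.

Let monomial (p1 p2 p3 : {poly R}) (w : T) : R := p1.[x w] * p2.[y w] * p3.[z w].
Let mean p1 p2 p3 : R := fine 'E_P[monomial p1 p2 p3].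

Lemma integrable_monomial p1 p2 p3 :
  P.-integrable [set: T] (EFin \o monomial p1 p2 p3).
Proof. exact: (hcl p1 p2 p3).1. Qed.

Let iM := integrable_monomial.

Lemma ae_bounded_first : exists M : R, {ae P, forall w, `|x w| <= M}.
Proof.
have [M [M0 bM]] := q_gaussian_moment_bound hX; exists (M + 1).
apply: ae_bounded_of_moments => // k.
have -> : (fun w => x w ^+ k.*2) = monomial 'X^(k.*2) 1 1.
  by apply/funext => w; rewrite /monomial !hornerE.
rewrite expectation_fineK // lee_fin -lecR; have [_ <-] := hcl 'X^(k.*2) 1 1.
by rewrite /vacuum_state /= !poly_op1.
Qed.

Lemma ae_bounded_last : exists M : R, {ae P, forall w, `|z w| <= M}.
Proof.
have [M [M0 bM]] := q_gaussian_moment_bound hZ; exists (M + 1).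
apply: ae_bounded_of_moments => // k.
have -> : (fun w => z w ^+ k.*2) = monomial 1 1 'X^(k.*2).
  by apply/funext => w; rewrite /monomial !hornerE.
rewrite expectation_fineK // lee_fin -lecR; have [_ <-] := hcl 1 1 'X^(k.*2).
by rewrite /vacuum_state /= !poly_op1.
Qed.

Lemma cond_exp_linear (a b : R) :
  inner g f = a * inner f f + b * inner h f ->
  inner g h = a * inner f h + b * inner h h ->
  cond_exp_ae_eq P (g_sigma_preimageU x z) y (fun w => a * x w + b * z w).
Proof.
move=> gf gh; have [M xM] := ae_bounded_first; have [N zN] := ae_bounded_last.
have mean_linear p1 p3 :
    mean p1 'X p3 = a * mean (p1 * 'X) 1 p3 + b * mean p1 1 (p3 * 'X).
  apply: real_complex_inj.
  have := q_gaussian_mean_linear hX hY hZ p1 p3 gf gh.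
  by rewrite !(hcl _ _ _).2 rmorphD !rmorphM.
apply: (cond_exp_of_moments _ _ _ xM zN).
- have -> : (y : T -> R) = monomial 1 'X 1; last exact: iM.
  by apply/funext => w; rewrite /monomial !hornerE.
(* The zero polynomial supplies the last summand of the linear combination. *)
- have [+ _] := expectation_lincomb a (iM 'X 1 1)
    (expectation_lincomb b (iM 1 1 'X) (iM 0 1 1)).1.
  congr (P.-integrable _ _); apply/funext => w /=; congr EFin.
  by rewrite /monomial !hornerE /=; ring.
- move=> S mS; rewrite (_ : (fun w => a * x w + b * z w) = fun w =>
    0 * x w ^+ 2 + 0 * x w * z w + 0 * z w ^+ 2 + 0 + a * x w + b * z w).
    exact: g_sigma_preimageU_polynomial.
  by apply/funext => w; ring.
move=> p r.
(* The tested residual is split into monomials, factors [x] and [z] being absorbed in [p] and [r];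
   the transferred moment identity then cancels their expectations. *)
have [i1 e1] := expectation_lincomb (- b) (iM p 1 (r * 'X)) (iM p 'X r).
have [i2 e2] := expectation_lincomb (- a) (iM (p * 'X) 1 r) i1.
rewrite [X in expectation P X](_ : _ = fun w => - a * monomial (p * 'X) 1 r w +
  (- b * monomial p 1 (r * 'X) w + monomial p 'X r w)); last first.
  by apply/funext => w; rewrite /monomial !hornerE /=; ring.
rewrite expectation_fineK // e2 e1; congr EFin.
rewrite -/(mean _ _ _) -/(mean _ _ _) -/(mean _ _ _) mean_linear; ring.
Qed.

Lemma cond_exp_quadratic (A B C D : R) :
  (1 + q) * (inner g f * inner g h) =
    A * ((1 + q) * (inner f f * inner f h)) +
    B * (inner f f * inner h h + q * (inner f h * inner h f)) +
    C * ((1 + q) * (inner h f * inner h h)) ->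
  inner g f ^+ 2 = A * inner f f ^+ 2 + B * (inner f f * inner h f) +
    C * inner h f ^+ 2 ->
  inner g h ^+ 2 = A * inner f h ^+ 2 + B * (inner f h * inner h h) +
    C * inner h h ^+ 2 ->
  inner g g = A * inner f f + B * inner f h + C * inner h h + D ->
  cond_exp_ae_eq P (g_sigma_preimageU x z) (fun w => y w ^+ 2)
    (fun w => A * x w ^+ 2 + B * x w * z w + C * z w ^+ 2 + D).
Proof.
move=> e11 e20 e02 e00.
have [M xM] := ae_bounded_first; have [N zN] := ae_bounded_last.
have mean_quadratic p1 p3 : mean p1 'X^2 p3 = A * mean (p1 * 'X^2) 1 p3 +
    B * mean (p1 * 'X) 1 (p3 * 'X) + C * mean p1 1 (p3 * 'X^2) + D * mean p1 1 p3.
  apply: real_complex_inj.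
  have := q_gaussian_mean_quadratic hX hY hZ p1 p3 e11 e20 e02 e00.
  by rewrite !(hcl _ _ _).2 !rmorphD !rmorphM.
apply: (cond_exp_of_moments _ _ _ xM zN).
- have -> : (fun w => y w ^+ 2) = monomial 1 'X^2 1; last exact: iM.
  by apply/funext => w; rewrite /monomial !hornerE.
- have [+ _] := expectation_lincomb A (iM 'X^2 1 1)
    (expectation_lincomb B (iM 'X 1 'X)
    (expectation_lincomb C (iM 1 1 'X^2) (iM D%:P 1 1)).1).1.
  congr (P.-integrable _ _); apply/funext => w /=; congr EFin.
  by rewrite /monomial !hornerE /=; ring.
- move=> S mS; rewrite (_ : (fun w => _ + D) = fun w =>
    A * x w ^+ 2 + B * x w * z w + C * z w ^+ 2 + D + 0 * x w + 0 * z w).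
    exact: g_sigma_preimageU_polynomial.
  by apply/funext => w; ring.
move=> p r.
have [i1 e1] := expectation_lincomb (- D) (iM p 1 r) (iM p 'X^2 r).
have [i2 e2] := expectation_lincomb (- C) (iM p 1 (r * 'X^2)) i1.
have [i3 e3] := expectation_lincomb (- B) (iM (p * 'X) 1 (r * 'X)) i2.
have [i4 e4] := expectation_lincomb (- A) (iM (p * 'X^2) 1 r) i3.
rewrite [X in expectation P X](_ : _ = fun w => - A * monomial (p * 'X^2) 1 r w +
  (- B * monomial (p * 'X) 1 (r * 'X) w + (- C * monomial p 1 (r * 'X^2) w +
  (- D * monomial p 1 r w + monomial p 'X^2 r w)))); last first.
  by apply/funext => w; rewrite /monomial !hornerE /=; ring.
rewrite expectation_fineK // e4 e3 e2 e1; congr EFin.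
rewrite -!/(mean _ _ _) mean_quadratic; ring.
Qed.

End ClassicalVersionMoments.

(** With c = <f,h>, the vector f - c h is nonzero by independence, and its square norm is 1 -
    c^2. *)
Lemma inner_free_lt1 (R : realType) (H : realHilbertSpace R) (f h : H) :
  `|f| = 1 -> `|h| = 1 ->
  (forall s t : R, s *: f + t *: h = 0 -> s = 0 /\ t = 0) ->
  inner f h ^+ 2 < 1.
Proof.
move=> f1 h1 free; set c := inner f h.
have hf : inner h f = c by rewrite inner_conj.
have : 0 < inner (f - c *: h) (f - c *: h).
  rewrite inner_normE exprn_gt0 // normr_gt0; apply/eqP => e.
  have [] := free 1 (- c); first by rewrite scale1r scaleNr.
  by move/eqP; rewrite oner_eq0.
rewrite innerBl !innerBr !innerZl !innerZr !inner_normE f1 h1 hf -/c /=.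
rewrite !expr1n /idfun. nra.
Qed.

Unset Implicit Arguments.

Theorem theorem2 (R : realType) (q : R) (hq : -1 < q < 1)
  (H : realHilbertSpace R) (F : qFockSpace q H) (f g h : H)
  (hf : `|f| = 1) (hg : `|g| = 1) (hh : `|h| = 1)
  (hfh : forall s t : R, s *: f + t *: h = 0 -> s = 0 /\ t = 0)
  (X Y Z : F -> F)
  (hX : is_q_gaussian f X) (hY : is_q_gaussian g Y) (hZ : is_q_gaussian h Z)
  (d : measure_display) (T : measurableType d) (P : probability T R)
  (x y z : {RV P >-> R})
  (hcl : classical_version X Y Z x y z) :
  let fg := inner f g in
  let gh := inner g h in
  let fh := inner f h in
  let a := (fg - gh * fh) / (1 - fh ^+ 2) in
  let b := (gh - fg * fh) / (1 - fh ^+ 2) in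
  let A := (a * b * (1 - q) * fh + a ^+ 2 * (1 - q * fh ^+ 2))
             / (1 - q * fh ^+ 2) in
  let B := (a * b * (1 + q) * (1 - fh ^+ 2)) / (1 - q * fh ^+ 2) in
  let C := (a * b * (1 - q) * fh + b ^+ 2 * (1 - q * fh ^+ 2))
             / (1 - q * fh ^+ 2) in
  let D := 1 - A - B * fh - C in
  let G := g_sigma_preimageU x z in
  cond_exp_ae_eq P G y (fun w => a * x w + b * z w) /\
  cond_exp_ae_eq P G (fun w => y w ^+ 2)
    (fun w => A * x w ^+ 2 + B * x w * z w + C * z w ^+ 2 + D).
Proof.
move=> fg gh fh a b A B C D G.
have [X' eX] := q_gaussian_linear hX; rewrite {X}eX in hX hcl.
have [Y' eY] := q_gaussian_linear hY; rewrite {Y}eY in hY hcl.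
have [Z' eZ] := q_gaussian_linear hZ; rewrite {Z}eZ in hZ hcl.
have ff : inner f f = 1 by rewrite inner_normE hf expr1n.
have gg : inner g g = 1 by rewrite inner_normE hg expr1n.
have hh1 : inner h h = 1 by rewrite inner_normE hh expr1n.
have hfE : inner h f = fh by rewrite inner_conj.
have c1 : fh ^+ 2 < 1 by exact: inner_free_lt1.
have d1 : 1 - fh ^+ 2 != 0 by rewrite subr_eq0 eq_sym lt_eqF.
(* From q < 1 and 0 <= <f,h>^2 < 1. *)
have d2 : 1 - q * fh ^+ 2 != 0.
  rewrite subr_eq0 eq_sym lt_eqF //.
  by have := sqr_ge0 fh; move: hq => /andP[_ q1]; nra.
(* With [ghE], these are the normal equations: a f + b h is the orthogonal projection of [g] onto
   the span of [f] and [h]. *)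
have gfE : inner g f = a + b * fh.
  by rewrite inner_conj /= -/fg /a /b; field.
have ghE : inner g h = a * fh + b by rewrite -/gh /a /b; field.
(* From here only the normal equations about [a] and [b] are used; [A], [B], [C] solve three linear
   equations with coefficients in a, b, q and <f,h>. *)
rewrite /G; clearbody a b; split.
  by apply: (cond_exp_linear hX hY hZ hcl); rewrite ?gfE ?ghE ?ff ?hh1 ?hfE; ring.
apply: (cond_exp_quadratic hX hY hZ hcl); rewrite ?gfE ?ghE ?ff ?hh1 ?hfE.
- by rewrite /A /B /C; field.
- by rewrite /A /B /C; field.
- by rewrite /A /B /C; field.
- by rewrite gg /D; ring.
Qed.
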